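(* In the setting described in the context, for each $i\in\overline{1m}$ let $$\hat V^w_i:=\Pi_Z\big(T_i(\hat A_i)+b_i\big)\setminus\big(\hat f(\hat A)+\mathrm{int}_Z(C_Z)\big)$$ and $$\breve S_i:=\hat A_i\cap(\Pi_Z\circ T_i)^{-1}\big(\hat V^w_i-\Pi_Z(b_i)\big).$$ Suppose that $(\hat T(X_1)\oplus Z)\cap\mathrm{int}(C)\neq\emptyset$, and let $\bar I:=\{i\in\overline{1m}:\hat A_i\neq\emptyset\}$. Then the following statements hold: (i) $\hat S^w=\bigcup_{i\in\bar I}\breve S_i$ and $\mathrm{WE}\big(\hat f(\hat A),C_Z\big)=\bigcup_{i\in\bar I}\hat V^w_i$. (ii) If, in addition, the ordering cone $C$ in $Y$ is polyhedral, then for each $i\in\bar I$ there exist finitely many (possibly zero) polyhedra $\hat P_{i1},\dots,\hat P_{ip_i}$ in $X_2$ and faces $\hat F_{i1},\dots,\hat F_{ip_i}$ of $\hat A_i$ such that $\breve S_i=\bigcup_{j=1}^{p_i}\hat P_{ij}$ and $\hat P_{ij}\subset\hat F_{ij}\subset\hat S^w_i$ for all $j\in\overline{1p_i}$. Consequently, $\hat S^w$ is the union of finitely many polyhedra in $X_2$, each one of which is contained in a weak Pareto face of some linear subproblem $(\widehat{\mathrm{LP}})_i$.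
   Context: Notation. $\overline{1m}:=\{1,\dots,m\}$; $\mathcal{L}(X,Y)$ is the space of continuous linear operators; for $x^*\in X^*$, $\mathcal{N}(x^* )$ is its null space. A polyhedron in a normed space is the solution set of finitely many inequalities $\langle u^*,x\rangle\le s$ with $u^*$ in the dual space, $s\in\mathbb{R}$; a cone is polyhedral if it is a polyhedron. A face of a polyhedron $P$ means an exposed face: a set $\{u\in P:\langle x^*,u\rangle=\sup_{x\in P}\langle x^*,x\rangle\}$ for some continuous linear functional $x^*$ (possibly $0$). $\mathcal{PL}(X,Y)$ is the set of $f:X\to Y$ such that $X$ is a finite union of polyhedra $P_i$ with $f=T_i+b_i$ on $P_i$ for some $T_i\in\mathcal{L}(X,Y)$, $b_i\in Y$. Efficiency. For a convex cone $K$ in a normed space $W$ with $\mathrm{int}(K)\neq\emptyset$ and $\Omega\subset W$, $\mathrm{WE}(\Omega,K)$ is the set of $\omega\in\Omega$ for which there is no $v\in\Omega$ with $\omega-v\in\mathrm{int}(K)$. Setting. $X,Y$ are normed spaces, $C\subset Y$ is a closed convex cone, $f\in\mathcal{PL}(X,Y)$, $\varphi_1,\dots,\varphi_l\in\mathcal{PL}(X,\mathbb{R})$. Fixed data: $T_i\in\mathcal{L}(X,Y)$, $u_{ik}^*,x_{ij}^*\in X^*$, $b_i\in Y$, $t_{ik},c_{ij}\in\mathbb{R}$ ($i\in\overline{1m}$, $k\in\overline{1q_i}$, $j\in\overline{1l}$) with $P_i=\{x\in X:\langle u_{ik}^*,x\rangle\le t_{ik}\ \forall k\in\overline{1q_i}\}$,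 $X=\bigcup_{i=1}^mP_i$, $\mathrm{int}(P_i)\neq\emptyset$, $P_i\cap\mathrm{int}(P_{i'})=\emptyset$ for $i\neq i'$, and $f=T_i+b_i$, $\varphi_j=x_{ij}^*-c_{ij}$ on $P_i$ for all $i,j$. Reduction. $X_1:=\bigcap_{i\in\overline{1m}}\bigcap_{(j,k)\in\overline{1l}\times\overline{1q_i}}\mathcal{N}(x_{ij}^* )\cap\mathcal{N}(u_{ik}^* )$. Let $\{e_1^*,\dots,e_\nu^*\}$ be a maximal linearly independent subset of $\{u_{ik}^*,x_{ij}^*\}$ (over all $i,j,k$), for each $\iota\in\overline{1\nu}$ choose $h_\iota\in X$ with $\langle e_\iota^*,h_\iota\rangle=1$ and $\langle e_{\iota'}^*,h_\iota\rangle=0$ for $\iota'\neq\iota$, and put $X_2:=\mathrm{span}\{h_1,\dots,h_\nu\}$; then $X=X_1\oplus X_2$. The restrictions of $T_1,\dots,T_m$ to $X_1$ coincide; $\hat T:=T_1|_{X_1}=\cdots=T_m|_{X_1}$. Let $D:=\bigcup_{i=1}^m\{T_i(h_1),\dots,T_i(h_\nu),b_i\}$ and choose $u_1,\dots,u_\varsigma\in D$ with $\varsigma$ maximal such that $u_1\in D\setminus\hat T(X_1)$, $u_2\in D\setminus(\hat T(X_1)+\mathrm{span}\{u_1\})$, ..., $u_\varsigma\in D\setminus(\hat T(X_1)+\mathrm{span}\{u_1,\dots,u_{\varsigma-1}\})$; put $Z:=\mathrm{span}\{u_1,\dots,u_\varsigma\}$, so $\hat T(X_1)\cap Z=\{0\}$.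 $\Pi_Z:\hat T(X_1)\oplus Z\to Z$ is the projection $\Pi_Z(y+z):=z$ for $(y,z)\in\hat T(X_1)\times Z$. $C_Z:=\Pi_Z((\hat T(X_1)\oplus Z)\cap C)$, a convex cone in $Z$, and $\mathrm{int}_Z$ is the interior relative to $Z$ (under the assumption $(\hat T(X_1)\oplus Z)\cap\mathrm{int}(C)\neq\emptyset$ one has $\mathrm{int}_Z(C_Z)\neq\emptyset$). One has $f(X)\subset\hat T(X_1)\oplus Z$; define $\hat f:X_2\to Z$, $\hat f(x_2):=\Pi_Z(f(x_2))$. In $(\Pi_Z\circ T_i)^{-1}$, the map $\Pi_Z\circ T_i$ is considered on $X_2$. Problem $(\widehat{\mathrm{PLP}})$: $C_Z$-min $\hat f(x_2)$ subject to $x_2\in\hat A:=\{x_2\in X_2:\varphi_j(x_2)\le0\ \forall j\in\overline{1l}\}$; $\hat S^w:=\{x_2\in\hat A:\hat f(x_2)\in\mathrm{WE}(\hat f(\hat A),C_Z)\}$ is its weak Pareto solution set. For $i\in\overline{1m}$ let $\hat P_i:=\{x_2\in X_2:\langle u_{ik}^*,x_2\rangle\le t_{ik}\ \forall k\in\overline{1q_i}\}$ and $\hat A_i:=\{x_2\in\hat P_i:\langle x_{ij}^*,x_2\rangle\le c_{ij}\ \forall j\in\overline{1l}\}$. The linear subproblem $(\widehat{\mathrm{LP}})_i$ is: $C_Z$-min $\Pi_Z(T_ix+b_i)$ subject to $x\in\hat A_i$; its weak Pareto solution set $\hat S_i^w$ is the set of $x\in\hat A_i$ with $\Pi_Z(T_ix+b_i)\in\mathrm{WE}(\Pi_Z(T_i(\hat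 A_i)+b_i),C_Z)$. A weak Pareto face of $(\widehat{\mathrm{LP}})_i$ is a face of $\hat A_i$ contained in $\hat S_i^w$. *)

(* Defs.v *)
From HB Require Import structures.
From mathcomp Require Import all_boot all_order all_algebra.
From mathcomp Require Import all_classical all_reals all_analysis.

Set Implicit Arguments.
Unset Strict Implicit.
Unset Printing Implicit Defensive.

Import Order.TTheory GRing.Theory Num.Theory.
Import numFieldNormedType.Exports.

Local Open Scope classical_set_scope.
Local Open Scope ring_scope.

Section linear_algebra.
Context {R : realType} {V : lmodType R}.
Implicit Types A B W Z : set V.

Definition span A : set V :=
  [set y | exists n (a : 'I_n -> R) (v : 'I_n -> V),
     (forall i, A (v i)) /\ y = \sum_i a i *: v i].

Definition sumset A B : set V := [set x + y | x in A & y in B].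

Definition lin_indep A : Prop :=
  forall n (v : 'I_n -> V), injective v -> (forall i, A (v i)) ->
  forall a : 'I_n -> R, \sum_i a i *: v i = 0 -> forall i, a i = 0.

Definition maximal_lin_indep S E : Prop :=
  [/\ E `<=` S, lin_indep E &
      forall E', E `<=` E' -> E' `<=` S -> lin_indep E' -> E' = E].

(* w + z |-> z for (w, z) in W x Z, when W and Z are subspaces with
   W `&` Z = [set 0]; it is 0 outside of sumset W Z. *)
Definition proj_along W Z (y : V) : V :=
  xget 0 [set z | Z z /\ exists2 w, W w & y = w + z].

End linear_algebra.

(* The notions relative to a linear subspace W of V (X_2 in X, Z in Y, or W = V)
   are expressed with subsets of V contained in W. *)
Section subspace_notions.
Context {R : realType} {V : normedModType R}.
Implicit Types A K W P F : set V.

(* u restricts to a continuous linear functional on W; its values outside of W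
   are irrelevant. *)
Definition functional_on W (u : V -> R) : Prop :=
  (forall (a : R) x y, W x -> W y -> u (a *: x + y) = a * u x + u y) /\
  {within W, continuous u}.

Definition polyhedron_in W P : Prop :=
  exists n (u : 'I_n -> V -> R) (s : 'I_n -> R),
    (forall k, functional_on W (u k)) /\
    P = [set x | W x /\ forall k, u k x <= s k].

(* The supremum is taken in \bar R: a functional that is unbounded above on P
   exposes the empty set. *)
Definition face_in W P F : Prop :=
  exists2 u : V -> R, functional_on W u &
    F = [set x | P x /\ (u x)%:E = ereal_sup [set (u y)%:E | y in P]].

Definition interior_in W A : set V := [set x | W x /\ within W (nbhs x) A].

Definition WE_in W A K : set V :=
  [set y | A y /\ ~ exists2 v, A v & interior_in W K (y - v)].

Definition convex_cone K : Prop :=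
  [/\ K !=set0, convex_set K &
      forall (a : R) x, 0 <= a -> K x -> K (a *: x)].

End subspace_notions.

Definition piecewise_linear {R : realType} {X Y : normedModType R}
    (f : X -> Y) : Prop :=
  exists n (P : 'I_n -> set X) (T : 'I_n -> {linear X -> Y}) (b : 'I_n -> Y),
    [/\ forall i, polyhedron_in setT (P i),
        \bigcup_i P i = setT,
        forall i, continuous (T i) &
        forall i x, P i x -> f x = T i x + b i].

(* X is nonempty, so there is at least one piece: the pieces are indexed by
   'I_m.+1, and ord0 is the first one. *)
Record plp_data {R : realType} {X Y : normedModType R} := PlpData {
  pl_m : nat;
  pl_l : nat;
  pl_q : 'I_pl_m.+1 -> nat;
  pl_T : 'I_pl_m.+1 -> {linear X -> Y};
  pl_b : 'I_pl_m.+1 -> Y;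
  pl_u : forall i : 'I_pl_m.+1, 'I_(pl_q i) -> {linear X -> R^o};
  pl_t : forall i : 'I_pl_m.+1, 'I_(pl_q i) -> R;
  pl_x : 'I_pl_m.+1 -> 'I_pl_l -> {linear X -> R^o};
  pl_c : 'I_pl_m.+1 -> 'I_pl_l -> R;
  pl_C : set Y;
  pl_f : X -> Y;
  pl_phi : 'I_pl_l -> X -> R
}.
Arguments plp_data {R} X Y.
Arguments pl_q {R X Y} p i : rename.
Arguments pl_T {R X Y} p i : rename.
Arguments pl_b {R X Y} p i : rename.
Arguments pl_u {R X Y} p i k : rename.
Arguments pl_t {R X Y} p i k : rename.
Arguments pl_x {R X Y} p i j : rename.
Arguments pl_c {R X Y} p i j : rename.
Arguments pl_phi {R X Y} p j x : rename.

Section setting.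
Context {R : realType} {X Y : normedModType R} (p : plp_data X Y).

Definition piece (i : 'I_(pl_m p).+1) : set X :=
  [set x | forall k, pl_u p i k x <= pl_t p i k].

Record plp_setting : Prop := PlpSetting {
  C_closed : closed (pl_C p);
  C_convex_cone : convex_cone (pl_C p);
  f_PL : piecewise_linear (pl_f p);
  phi_PL : forall j, piecewise_linear (pl_phi p j : X -> R^o);
  T_continuous : forall i, continuous (pl_T p i);
  u_continuous : forall i k, continuous (pl_u p i k);
  x_continuous : forall i j, continuous (pl_x p i j);
  piece_cover : \bigcup_i piece i = setT;
  piece_interior : forall i, (piece i)° !=set0;
  piece_disjoint : forall i i', i != i' -> piece i `&` (piece i')° = set0;
  f_piece : forall i x, piece i x -> pl_f p x = pl_T p i x + pl_b p i;
  phi_piece : forall i j x, piece i x ->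
    pl_phi p j x = pl_x p i j x - pl_c p i j
}.

(* The intersection runs over all the pl_u and all the pl_x, also when pl_l or
   some pl_q i is 0. *)
Definition X1 : set X :=
  [set x | (forall i k, pl_u p i k x = 0) /\ (forall i j, pl_x p i j x = 0)].

Definition all_functionals : set (X -> R^o) :=
  [set g : X -> R^o |
    (exists i k, g = pl_u p i k) \/ (exists i j, g = pl_x p i j)].

Definition TX1 : set Y := pl_T p ord0 @` X1.

Definition Dset (nu : nat) (h : 'I_nu -> X) : set Y :=
  [set y | exists i, (exists k, y = pl_T p i (h k)) \/ y = pl_b p i].

Definition successive (D : set Y) (n : nat) (w : 'I_n -> Y) : Prop :=
  forall k, D (w k) /\
    ~ sumset TX1 (span (w @` [set k' : 'I_n | (k' < k)%N])) (w k).

End setting.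

Record reduction_data {R : realType} {X Y : normedModType R} := ReductionData {
  red_nu : nat;
  red_e : 'I_red_nu -> {linear X -> R^o};
  red_h : 'I_red_nu -> X;
  red_sigma : nat;
  red_w : 'I_red_sigma -> Y
}.
Arguments reduction_data {R} X Y.
Arguments red_e {R X Y} r k : rename.
Arguments red_h {R X Y} r k : rename.
Arguments red_w {R X Y} r k : rename.

Section reduction.
Context {R : realType} {X Y : normedModType R}.
Variables (p : plp_data X Y) (r : reduction_data X Y).

Record reduction_of : Prop := ReductionOf {
  e_inj : injective (fun k => red_e r k : X -> R^o);
  e_maximal : maximal_lin_indep (all_functionals p)
    (range (fun k => red_e r k : X -> R^o));
  e_h : forall k k', red_e r k (red_h r k') = (k == k')%:R;
  w_successive : successive p (Dset p (red_h r)) (red_w r);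
  sigma_maximal : forall n (w : 'I_n -> Y),
    successive p (Dset p (red_h r)) w -> (n <= red_sigma r)%N
}.

Definition X2 : set X := span (range (red_h r)).
Definition Z : set Y := span (range (red_w r)).
Definition TX1Z : set Y := sumset (TX1 p) Z.
Definition PiZ : Y -> Y := proj_along (TX1 p) Z.
Definition CZ : set Y := PiZ @` (TX1Z `&` pl_C p).

Definition fhat (x : X) : Y := PiZ (pl_f p x).
Definition Ahat : set X := [set x | X2 x /\ forall j, pl_phi p j x <= 0].
Definition Shat : set X :=
  [set x | Ahat x /\ WE_in Z (fhat @` Ahat) CZ (fhat x)].

Section subproblem.
Variable i : 'I_(pl_m p).+1.

Definition Phat : set X :=
  [set x | X2 x /\ forall k, pl_u p i k x <= pl_t p i k].
Definition Ahati : set X :=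
  [set x | Phat x /\ forall j, pl_x p i j x <= pl_c p i j].
Definition LPobj (x : X) : Y := PiZ (pl_T p i x + pl_b p i).
Definition Shati : set X :=
  [set x | Ahati x /\ WE_in Z (LPobj @` Ahati) CZ (LPobj x)].
Definition weak_Pareto_face (F : set X) : Prop :=
  face_in X2 Ahati F /\ F `<=` Shati.

Definition Vhat : set Y :=
  (LPobj @` Ahati) `\` sumset (fhat @` Ahat) (interior_in Z CZ).
Definition Sbreve : set X :=
  Ahati `&`
  [set x | X2 x /\ [set v - PiZ (pl_b p i) | v in Vhat] (PiZ (pl_T p i x))].

End subproblem.

Definition Ibar : set 'I_(pl_m p).+1 := [set i | Ahati i !=set0].

End reduction.
Arguments Phat {R X Y} p r i _.
Arguments Ahati {R X Y} p r i _.
Arguments LPobj {R X Y} p r i x.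
Arguments Shati {R X Y} p r i _.
Arguments weak_Pareto_face {R X Y} p r i F.
Arguments Vhat {R X Y} p r i _.
Arguments Sbreve {R X Y} p r i _.
Arguments Ibar {R X Y} p r _.

(* Main.v *)
Require Import Defs.
From HB Require Import structures.
From mathcomp Require Import all_boot all_order all_algebra.
From mathcomp Require Import all_classical all_reals all_analysis.
From mathcomp Require Import ring lra.

Set Implicit Arguments.
Unset Strict Implicit.
Unset Printing Implicit Defensive.

Import Order.TTheory GRing.Theory Num.Theory.
Import numFieldNormedType.Exports.

Local Open Scope classical_set_scope.
Local Open Scope ring_scope.

(* A value is dominated by the i-th piece iff it lies in
   D_i := LPobj_i(Ahat_i) + int CZ, so the first part is set algebra once Pi_Z is
   known to be additive on the sum of T(X1) and Z, which contains all T_i(h_k)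
   and b_i by maximality of the family spanning Z.

   If C is polyhedral, Fourier-Motzkin elimination of the T(X1)-component shows
   that CZ is polyhedral, and elimination of the decision variable then shows that
   D_i is cut out of Z by finitely many strict affine inequalities g_ij < 0. Hence
   Sbreve_i is the union, over all choices j = s(i'), of the polyhedra
   {x in Ahat_i | g_{i' s(i')} (LPobj_i x) >= 0 for all i'}. Since 0 lies in the
   closure of int CZ, the function g_{i s(i)} o LPobj_i is <= 0 on Ahat_i, so the
   inequality for i' = i confines a nonempty polyhedron of this kind to the face
   where that function attains its maximum 0, and no point of this face has a
   value in D_i. *)

(** * Fourier-Motzkin elimination *)

(** It suffices to compare the largest lower bound with the smallest upper bound. If one of the
    index types is empty, any [t] beyond the sum of the absolute values of the remaining bounds
    works. *)
Lemma exists_between (R : realFieldType) (I J : finType) (C : I -> bool)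
    (D : J -> bool) (a : I -> R) (b : J -> R) :
  (forall i j, a i < b j ?<= if C i && D j) ->
  exists t, (forall i, a i < t ?<= if C i) /\ (forall j, t < b j ?<= if D j).
Proof.
move=> ab.
have [i0 _|I0] := pickP (@predT I); last first.
  exists (- 1 - \sum_j `|b j|); split=> [i|j]; first by have := I0 i.
  apply: lteifS; rewrite (bigD1 j) //=.
  have : 0 <= \sum_(i | i != j) `|b i| by apply: sumr_ge0.
  have : - b j <= `|b j| by rewrite -normrN ler_norm.
  lra.
have [j0 _|J0] := pickP (@predT J); last first.
  exists (1 + \sum_i `|a i|); split=> [i|j]; last by have := J0 j.
  apply: lteifS; rewrite (bigD1 i) //=.
  have : 0 <= \sum_(j | j != i) `|a j| by apply: sumr_ge0.
  have : a i <= `|a i| by rewrite ler_norm.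
  lra.
case: (@Order.TotalTheory.arg_maxP _ _ _ i0 predT a isT) => i1 _ maxi.
case: (@Order.TotalTheory.arg_minP _ _ _ j0 predT b isT) => j1 _ minj.
have /lteifW := ab i1 j1; rewrite /= le_eqVlt => /orP[/eqP e|lt].
  (* The extremal bounds coincide. A strict bound on either side is then strict against the opposite
     extremal bound, that is against this common value. *)
  exists (a i1); split=> [i|j].
    have := ab i j1; have := maxi i isT; rewrite -e.
    by case: (C i) (D j1) => [] [] /=; rewrite ?ge_max.
  have := ab i1 j; have := minj j isT; rewrite -e.
  by case: (C i1) (D j) => [] [] /=.
exists ((a i1 + b j1) / 2); split=> [i|j]; apply: lteifS.
  have := maxi i isT; rewrite /=; lra.
have := minj j isT; rewrite /=; lra.
Qed.

(* A system consists of weak ([C i = true]) and strict inequalities; [P] is an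
   invariant of the pairs (flag, function) which survives elimination. *)
Definition combinable (R : realFieldType) (T : Type)
    (P : bool -> (T -> R) -> Prop) : Prop :=
  forall C C' g g' a a', 0 < a -> 0 < a' -> P C g -> P C' g' ->
    P (C && C') (fun x => a * g x + a' * g' x).

(** By the sign of [c i], a constraint bounds [t] from below ([N]), from above ([U]), or does not
    involve it ([E]). Those in [E] are kept, and each pair from [N * U] is combined with positive
    multipliers that cancel [t]; the result is strict unless both members are weak. *)
Lemma eliminate_variable (R : realFieldType) (T : Type)
    (P : bool -> (T -> R) -> Prop) (I : finType) (C : I -> bool)
    (g : I -> T -> R) (c : I -> R) :
  combinable P -> (forall i, P (C i) (g i)) ->
  exists (J : finType) (C' : J -> bool) (g' : J -> T -> R),
    (forall j, P (C' j) (g' j)) /\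
    forall x, (exists t, forall i, g i x + c i * t < 0 ?<= if C i) <->
      forall j, g' j x < 0 ?<= if C' j.
Proof.
move=> comb Pg.
pose N := {i | c i < 0}; pose U := {i | 0 < c i}; pose E := {i | c i == 0}.
exists (E + N * U)%type.
exists (fun j => match j with inl i => C (val i)
  | inr (i, i') => C (val i) && C (val i') end).
exists (fun j => match j with inl i => g (val i)
  | inr (i, i') =>
    fun x => c (val i') * g (val i) x + - c (val i) * g (val i') x end).
split=> [[i|[i i']]|x]; first exact: Pg.
  by apply: comb => //; rewrite ?oppr_gt0 ?(valP i) ?(valP i').
have bnd i : c i != 0 -> c i * (- g i x / c i) = - g i x.
  by move=> ci0; rewrite mulrC divfK.
split=> [[t tP] [[i /= /eqP ci0]|[[i /= ci] [i' /= ci']]]|h].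
- by have := tP i; rewrite ci0 mul0r addr0.
- have := tP i; have := tP i'.
  case: (C i) (C i') => [] [] /=; nra.
have [i i'|t [tN tU]] := @exists_between R N U (fun i => C (val i))
  (fun i => C (val i)) (fun i => - g (val i) x / c (val i))
  (fun i => - g (val i) x / c (val i)).
  have := h (inr (i, i')); case: i i' => [i /= ci] [i' /= ci'].
  have := bnd _ (lt0r_neq0 ci'); have := bnd _ (ltr0_neq0 ci).
  set s := _ / c i; set s' := _ / c i' => e e'.
  have -> : c i' * g i x + - c i * g i' x = c i * c i' * (s' - s).
    by rewrite -[g i x]opprK -[g i' x]opprK -e -e'; ring.
  (* Since this factor is negative, the combined inequality says precisely that the lower bound [s]
     lies below the upper bound [s']. *)
  have k_lt0 : c i * c i' < 0 by rewrite nmulr_rlt0.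
  by case: (C i && C i'); rewrite /= ?nmulr_rle0 ?nmulr_rlt0 ?subr_ge0 ?subr_gt0.
exists t => i; case: (ltgtP (c i) 0) => ci.
- have := tN (exist _ i ci); have /= := bnd _ (ltr0_neq0 ci).
  by set s := _ / c i => e; case: (C i) => /=; nra.
- have := tU (exist _ i ci); have /= := bnd _ (lt0r_neq0 ci).
  by set s := _ / c i => e; case: (C i) => /=; nra.
- have ci0 : c i == 0 by rewrite ci.
  by have := h (inl (exist _ i ci0)); rewrite /= ci mul0r addr0.
Qed.

Lemma eliminate_variables (R : realFieldType) (d : nat) (T : Type)
    (P : bool -> (T -> R) -> Prop) (I : finType) (C : I -> bool)
    (g : I -> T -> R) (c : I -> 'I_d -> R) :
  combinable P -> (forall i, P (C i) (g i)) ->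
  exists (J : finType) (C' : J -> bool) (g' : J -> T -> R),
    (forall j, P (C' j) (g' j)) /\
    forall x, (exists t : 'I_d -> R,
        forall i, g i x + \sum_k c i k * t k < 0 ?<= if C i) <->
      forall j, g' j x < 0 ?<= if C' j.
Proof.
elim: d T P I C g c => [|d IH] T P I C g c comb Pg.
  exists I, C, g; split=> // x; split=> [[t h] i|h].
    by have := h i; rewrite big_ord0 addr0.
  by exists (fun=> 0) => i; rewrite big_ord0 addr0.
(* The variable of index [ord0] joins the parameter while the induction hypothesis eliminates the
   others. [P'] records that the functions remain affine in it, so that it can be eliminated
   last. *)
pose P' C (G : T * R -> R) :=
  exists g0 a, P C g0 /\ G = fun y => g0 y.1 + a * y.2.
have comb' : combinable P'.
  move=> C1 C2 _ _ a1 a2 a1_gt0 a2_gt0 [g1 [c1 [Pg1 ->]]] [g2 [c2 [Pg2 ->]]].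
  exists (fun x => a1 * g1 x + a2 * g2 x), (a1 * c1 + a2 * c2).
  by split; [exact: comb|apply/funext => y; ring].
have [|J [C' [G [PG GE]]]] := IH _ P' I C
    (fun i y => g i y.1 + c i ord0 * y.2) (fun i k => c i (lift ord0 k)) comb'.
  by move=> i; exists (g i), (c i ord0).
pose g1 j := projT1 (cid (PG j)).
pose a1 j := projT1 (cid (projT2 (cid (PG j)))).
have PG1 j : P (C' j) (g1 j) /\ G j = fun y => g1 j y.1 + a1 j * y.2.
  exact: (projT2 (cid (projT2 (cid (PG j))))).
have [J' [C'' [g' [Pg' g'E]]]] :=
  eliminate_variable a1 comb (fun j => (PG1 j).1).
exists J', C'', g'; split=> // x; split=> [[t tP]|/g'E[t0 t0P]].
  apply/g'E; exists (t ord0) => j.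
  have := (GE (x, t ord0)).1 => /(_ _ j).
  have -> : G j (x, t ord0) = g1 j x + a1 j * t ord0 by rewrite [G j](PG1 j).2.
  apply; exists (fun k => t (lift ord0 k)) => i.
  by have := tP i; rewrite big_ord_recl addrA.
have [|t tP] := (GE (x, t0)).2.
  by move=> j; rewrite (PG1 j).2 /=; exact: t0P.
exists (fun k => if unlift ord0 k is Some k' then t k' else t0) => i.
rewrite big_ord_recl unlift_none addrA.
by under eq_bigr do rewrite liftK; exact: tP.
Qed.

(** * Linear subspaces, and elimination of a vector ranging over one *)

Definition vsubspace (R : realType) (V : lmodType R) (W : set V) : Prop :=
  W 0 /\ forall (a : R) x y, W x -> W y -> W (a *: x + y).

Definition linear_on (R : realType) (V V' : lmodType R) (W : set V)
    (g : V -> V') : Prop :=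
  forall (a : R) x y, W x -> W y -> g (a *: x + y) = a *: g x + g y.

Section subspaces.
Context {R : realType} {V : lmodType R}.
Implicit Types (W : set V) (x y : V).

Lemma vsubspaceZ W a x : vsubspace W -> W x -> W (a *: x).
Proof. by move=> [W0 Wl] Wx; rewrite -[a *: x]addr0; exact: Wl. Qed.

Lemma vsubspaceD W x y : vsubspace W -> W x -> W y -> W (x + y).
Proof. by move=> [_ Wl] Wx Wy; rewrite -[x]scale1r; exact: Wl. Qed.

Lemma vsubspaceB W x y : vsubspace W -> W x -> W y -> W (x - y).
Proof.
by move=> sW Wx Wy; rewrite -scaleN1r addrC; apply: sW.2.
Qed.

Lemma vsubspace_sum W (I : Type) (s : seq I) (P : pred I) (w : I -> V) :
  vsubspace W -> (forall i, P i -> W (w i)) -> W (\sum_(i <- s | P i) w i).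
Proof.
by move=> sW Ww; elim/big_ind: _ => //; [exact: sW.1|move=> *; exact: vsubspaceD].
Qed.

Lemma linear_on0 (V' : lmodType R) W (g : V -> V') :
  vsubspace W -> linear_on W g -> g 0 = 0.
Proof.
move=> sW gl; have := gl 1 0 0 sW.1 sW.1; rewrite !scale1r addr0.
by move/(congr1 (fun z => z - g 0)); rewrite subrr addrK.
Qed.

Lemma linear_onD (V' : lmodType R) W (g : V -> V') x y :
  linear_on W g -> W x -> W y -> g (x + y) = g x + g y.
Proof. by move=> gl Wx Wy; rewrite -[x]scale1r gl// !scale1r. Qed.

Lemma linear_onB (V' : lmodType R) W (g : V -> V') x y :
  linear_on W g -> W x -> W y -> g (x - y) = g x - g y.
Proof.
by move=> gl Wx Wy; rewrite -scaleN1r addrC gl// scaleN1r addrC.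
Qed.

Lemma linear_onN (V' : lmodType R) W (g : V -> V') :
  linear_on W g -> linear_on W (fun x => - g x).
Proof. by move=> gl a x y Wx Wy; rewrite gl// opprD scalerN. Qed.

Lemma linear_onZ (V' : lmodType R) W (g : V -> V') a x :
  vsubspace W -> linear_on W g -> W x -> g (a *: x) = a *: g x.
Proof.
by move=> sW gl Wx; rewrite -[a *: x]addr0 gl ?(linear_on0 sW gl) ?addr0//; exact: sW.1.
Qed.

Lemma linear_on_sum (V' : lmodType R) W (g : V -> V') d
    (t : 'I_d -> R) (w : 'I_d -> V) :
  vsubspace W -> linear_on W g -> (forall k, W (w k)) ->
  g (\sum_k t k *: w k) = \sum_k t k *: g (w k).
Proof.
move=> sW gl Ww; elim: d t w Ww => [|d IH] t w Ww.
  by rewrite !big_ord0 (linear_on0 sW gl).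
rewrite !big_ord_recl gl ?IH//.
by apply: vsubspace_sum => // k _; exact: vsubspaceZ.
Qed.

(** [W] may be infinite-dimensional, but finitely many functionals only see finitely many
    coordinates. By induction on [s]: split off a vector [w0] on which [b i0] does not vanish and
    continue in the kernel of [b i0] in [W]. *)
Lemma finite_coordinates (I : eqType) (s : seq I) W (b : I -> V -> R^o) :
  vsubspace W -> (forall i, linear_on W (b i)) ->
  exists d (w : 'I_d -> V), (forall k, W (w k)) /\
    forall x, W x -> exists t, forall i, i \in s ->
      b i x = \sum_k b i (w k) * t k.
Proof.
move=> sW bl; elim: s W sW bl => [|i0 s IH] W sW bl.
  exists 0%N, (fun=> 0); split=> [[]//|x _].
  by exists (fun=> 0).
have [w0 [Ww0 w0P]] : exists w0, W w0 /\
    forall x, W x -> b i0 w0 = 0 -> b i0 x = 0.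
  have [[w0 [Ww0 /eqP bw0]]|nz] := pselect (exists w0, W w0 /\ b i0 w0 <> 0).
    by exists w0; split=> // x _ /eqP; rewrite (negbTE bw0).
  (* If [b i0] vanishes on [W], the vector 0 serves as a dummy, and the quotient [t0] below is then
     0. *)
  exists 0; split=> [|x Wx _]; first exact: sW.1.
  by apply: contrapT => bx; apply: nz; exists x.
pose W' : set V := [set x | W x /\ b i0 x = 0].
have sW' : vsubspace W'.
  split=> [|a x y [Wx bx] [Wy by0]].
    by split; [exact: sW.1|exact: linear_on0 sW (bl i0)].
  by split; [exact: sW.2|rewrite bl// bx by0 scaler0 addr0].
have [|d [w [Ww wP]]] := IH W' sW'.
  by move=> i a x y [Wx _] [Wy _]; exact: bl.
exists d.+1, (fun k => if unlift ord0 k is Some k' then w k' else w0).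
split=> [k|x Wx]; first by case: unlift => // k'; have [] := Ww k'.
pose t0 := b i0 x / b i0 w0.
have Wt0 : W (t0 *: w0) by exact: vsubspaceZ.
have bB i : b i (x - t0 *: w0) = b i x - b i w0 * t0.
  by rewrite (linear_onB (bl i))// (linear_onZ _ sW (bl i))// [_ *: _]mulrC.
have b0 : b i0 (x - t0 *: w0) = 0.
  rewrite bB /t0; have [b00|b00] := eqVneq (b i0 w0) 0.
    by rewrite b00 (w0P _ Wx b00) mul0r subrr.
  by rewrite mulrCA divff// mulr1 subrr.
have [|t tP] := wP (x - t0 *: w0); first by split; first exact: vsubspaceB.
exists (fun k => if unlift ord0 k is Some k' then t k' else t0) => i.
rewrite inE big_ord_recl !unlift_none.
under eq_bigr do rewrite liftK.
have -> : b i x = b i w0 * t0 + b i (x - t0 *: w0) by rewrite bB addrC subrK.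
move=> /predU1P[->|si]; last by rewrite tP.
by rewrite b0 big1// => k _; rewrite (Ww k).2 mul0r.
Qed.

Lemma eliminate_subspace (T : Type) (P : bool -> (T -> R) -> Prop)
    (I : finType) (C : I -> bool) (g : I -> T -> R) W (b : I -> V -> R^o) :
  vsubspace W -> (forall i, linear_on W (b i)) ->
  combinable P -> (forall i, P (C i) (g i)) ->
  exists (J : finType) (C' : J -> bool) (g' : J -> T -> R),
    (forall j, P (C' j) (g' j)) /\
    forall x : T, (exists2 w, W w & forall i, g i x + b i w < 0 ?<= if C i) <->
      forall j, g' j x < 0 ?<= if C' j.
Proof.
move=> sW bl comb Pg.
have [d [w [Ww wP]]] := finite_coordinates (enum I) sW bl.
have [J [C' [g' [Pg' g'E]]]] :=
  eliminate_variables (fun i k => b i (w k)) comb Pg.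
exists J, C', g'; split=> // x; rewrite -g'E.
split=> [[y Wy yP]|[t tP]].
  have [t tP] := wP _ Wy.
  by exists t => i; rewrite -tP ?mem_enum//; exact: yP.
exists (\sum_k t k *: w k).
  by apply: vsubspace_sum => // k _; exact: vsubspaceZ.
move=> i; rewrite (linear_on_sum _ sW (bl i))//.
by under eq_bigr do rewrite /GRing.scale /= mulrC; exact: tP.
Qed.

End subspaces.

(** * Polyhedra and faces *)

Section affine.
Context {R : realType} {V : normedModType R}.
Implicit Types (W : set V) (g : V -> R).

Definition affine_on W g : Prop :=
  exists u s, functional_on W u /\ g = fun x => u x - s.

Lemma functional_onC W (u v : V -> R) (a b : R) :
  functional_on W u -> functional_on W v ->
  functional_on W (fun x => a * u x + b * v x).
Proof.
move=> [ul uc] [vl vc]; split=> [c x y Wx Wy|].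
  by rewrite ul// vl//; ring.
move=> x; apply: cvgD; apply: cvgMr; [exact: uc|exact: vc].
Qed.

Lemma functional_on0 W : functional_on W (fun=> 0).
Proof.
by split=> [a x y _ _|x]; [rewrite mulr0 addr0|exact: cvg_cst].
Qed.

Lemma affine_onC W g h (a b : R) : affine_on W g -> affine_on W h ->
  affine_on W (fun x => a * g x + b * h x).
Proof.
move=> [u [s [uW ->]]] [v [t [vW ->]]].
exists (fun x => a * u x + b * v x), (a * s + b * t).
by split; [exact: functional_onC|apply/funext => x; ring].
Qed.

Lemma affine_on_cst W c : affine_on W (fun=> c).
Proof.
exists (fun=> 0), (- c).
by split; [exact: functional_on0|apply/funext => x; rewrite opprK add0r].
Qed.

End affine.

Section span.
Context {R : realType} {V : lmodType R}.
Implicit Types A W : set V.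

Lemma subset_span A : A `<=` Defs.span A.
Proof.
by move=> x Ax; exists 1%N, (fun=> 1), (fun=> x); rewrite big_ord1 scale1r.
Qed.

Lemma vsubspace_span A : vsubspace (Defs.span A).
Proof.
split.
  by exists 0%N, (fun=> 0), (fun=> 0); split; [case|rewrite big_ord0].
move=> c x y [n [a [v [Av ->]]]] [m [b [w [Aw ->]]]].
exists (n + m)%N.
exists (fun i => match fintype.split i with inl j => c * a j | inr j => b j end).
exists (fun i => match fintype.split i with inl j => v j | inr j => w j end).
split=> [i|]; first by case: fintype.split.
rewrite big_split_ord scaler_sumr /=; congr (_ + _); apply: eq_bigr => i _.
  by rewrite (unsplitK (inl i)) scalerA.
by rewrite (unsplitK (inr i)).
Qed.

Lemma span_min A W : vsubspace W -> A `<=` W -> Defs.span A `<=` W.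
Proof.
move=> sW AW _ [n [a [v [Av ->]]]].
by apply: vsubspace_sum => // i _; apply: vsubspaceZ => //; exact: AW.
Qed.

Lemma span_rangeE n (v : 'I_n -> V) :
  Defs.span (range v) = [set x | exists a : 'I_n -> R, x = \sum_i a i *: v i].
Proof.
apply/seteqP; split=> [|_ [a ->]]; last by exists n, a, v; split=> // i; exists i.
apply: span_min.
  split; first by exists (fun=> 0); rewrite big1// => i _; rewrite scale0r.
  move=> c _ _ [a ->] [b ->]; exists (fun i => c * a i + b i).
  rewrite scaler_sumr -big_split /=; apply: eq_bigr => i _.
  by rewrite scalerDl scalerA.
move=> _ [i _ <-]; exists (fun j => (j == i)%:R).
rewrite (bigD1 i)//= eqxx scale1r big1 ?addr0// => j /negPf ->.
by rewrite scale0r.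
Qed.

End span.

Section polyhedra.
Context {R : realType} {V : normedModType R}.
Implicit Types (W Z : set V) (g : V -> R).

Lemma functional_on_linear W (u : V -> R^o) :
  functional_on W u -> linear_on W u.
Proof. by case. Qed.

Lemma functional_onS W W' (u : V -> R) :
  W `<=` W' -> functional_on W' u -> functional_on W u.
Proof.
move=> WW' [ul uc]; split=> [a x y /WW' Wx /WW' Wy|]; first exact: ul.
exact: continuous_subspaceW uc.
Qed.

(* A biorthogonal system of continuous functionals gives continuous coordinates
   on the span, so linearity alone suffices there. *)
Lemma functional_on_span n (h : 'I_n -> V) (e : 'I_n -> {linear V -> R^o})
    (u : V -> R^o) :
  (forall k, continuous (e k)) -> (forall k k', e k (h k') = (k == k')%:R) ->
  linear_on (Defs.span (range h)) u -> functional_on (Defs.span (range h)) u.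
Proof.
move=> ec eh ul; split=> //.
have uE x : Defs.span (range h) x -> \sum_k e k x * u (h k) = u x.
  rewrite span_rangeE => -[a ->].
  rewrite (linear_on_sum _ (vsubspace_span _) ul); last first.
    by move=> k; apply: subset_span; exists k.
  apply: eq_bigr => k _; rewrite linear_sum (bigD1 k)//= big1.
    by rewrite linearZ /= eh eqxx addr0 /GRing.scale /= mulr1.
  by move=> k' k'k; rewrite linearZ /= eh eq_sym (negPf k'k) scaler0.
apply: (@subspace_eq_continuous _ _ _ (fun x => \sum_k e k x * u (h k))).
  by move=> x /[!inE] /uE.
apply: continuous_subspaceT; elim: (index_enum _) => [|k s IH] x.
  by under eq_fun do rewrite big_nil; exact: cvg_cst.
under eq_fun do rewrite big_cons.
by rewrite /continuous_at; apply: cvgD; [apply: cvgMr_tmp; exact: ec|exact: IH].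
Qed.

Lemma polyhedron_in_finite W (K : finType) (u : K -> V -> R) (s : K -> R) :
  (forall k, functional_on W (u k)) ->
  polyhedron_in W [set x | W x /\ forall k, u k x <= s k].
Proof.
move=> uW; exists #|K|, (fun i => u (enum_val i)), (fun i => s (enum_val i)).
split=> //; apply/seteqP; split=> x [Wx ux]; split=> // k.
by have := ux (enum_rank k); rewrite enum_rankK.
Qed.

(** Elimination of [w] from the system defining [S]. The invariant [P] keeps every flag equal to
    [true], so only weak inequalities come out. *)
Lemma projection_polyhedron Z W (S : set V) :
  vsubspace W -> polyhedron_in [set: V] S ->
  exists (K : finType) (g : K -> V -> R), (forall k, affine_on Z (g k)) /\
    forall z, (exists2 w, W w & S (w + z)) <-> forall k, g k z <= 0.
Proof.
move=> sW [n [u [s [uV ->]]]].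
pose P (C : bool) (g : V -> R) := C /\ affine_on Z g.
have [|i|C C' g h a b _ _ [-> gZ] [-> hZ]|i|K [C [g [Pg gE]]]] :=
  @eliminate_subspace R V V P 'I_n (fun=> true) (fun i z => u i z - s i) W u.
- exact: sW.
- by apply: functional_on_linear; apply: functional_onS (uV i).
- by split=> //; exact: affine_onC.
- split=> //; exists (u i), (s i); split=> //.
  exact: functional_onS (uV i).
exists K, g; split=> [k|z]; first by have [] := Pg k.
have -> : (forall k, g k z <= 0) <-> (forall k, g k z < 0 ?<= if C k).
  by split=> h k; have := h k; rewrite (Pg k).1.
rewrite -gE; split=> -[w Ww h]; exists w => //.
  by move=> i; have := h.2 i; rewrite -[w in w + z]scale1r (uV i).1//=; lra.
by split=> // i; have := h i; rewrite /= -[w in w + z]scale1r (uV i).1//; lra.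
Qed.

Lemma affine_on_line Z g z d t : vsubspace Z -> affine_on Z g -> Z z -> Z d ->
  g (z + t *: d) = g z + t * (g d - g 0).
Proof.
move=> sZ [u [s [uZ ->]]] Zz Zd; rewrite /= [z + _]addrC uZ.1//.
have := linear_on0 sZ (functional_on_linear uZ); rewrite /= => ->.
by ring.
Qed.

(** A constraint that is constant on [Z] holds on all of [Z], because it holds at one point. A
    nonconstant one must be strict at an interior point, since otherwise a small move in a direction
    of increase leaves the polyhedron. *)
Lemma interior_in_polyhedron Z (K : finType) (g : K -> V -> R) :
  vsubspace Z -> (forall k, affine_on Z (g k)) ->
  (exists2 z, Z z & forall k, g k z <= 0) ->
  forall z, interior_in Z [set y | Z y /\ forall k, g k y <= 0] z <->
    Z z /\ forall k, (exists2 y, Z y & g k y <> g k 0) -> g k z < 0.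
Proof.
move=> sZ gZ [z0 Zz0 gz0] z; split=> -[Zz].
  rewrite /within /= => nS; split=> // k [y Zy gy].
  have gz : g k z <= 0 by have [] := nbhs_singleton nS Zz.
  rewrite lt_neqAle gz andbT; apply/eqP => gz_eq0.
  (* The scaling makes the slope of [g k] along [d] the square of [g k y - g k 0], hence positive
     whatever the sign of that difference. *)
  pose d := (g k y - g k 0) *: y.
  have Zd : Z d by exact: vsubspaceZ.
  have : \forall t \near (0 : R), Z (z + t *: d) -> g k (z + t *: d) <= 0.
    have zd : (fun t : R => z + t *: d) @ (0 : R) --> z.
      rewrite -[X in _ --> X]addr0 -[X in _ --> _ + X](scale0r d).
      by apply: cvgD; [exact: cvg_cst|apply: cvgZr_tmp; exact: cvg_id].
    apply: (@filterS _ (nbhs (0 : R)) _ _ _ _ (zd _ nS)) => t /= h Zt.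
    by have [_ /(_ k)] := h Zt.
  move=> /nbhs_ballP[e /= e_gt0 he].
  have /he : ball 0 e (e / 2).
    by rewrite /ball /= sub0r normrN gtr0_norm; lra.
  rewrite /= => /(_ (vsubspaceD sZ Zz (vsubspaceZ _ sZ Zd))).
  rewrite (affine_on_line _ sZ (gZ k))// gz_eq0 add0r leNgt => /negP; apply.
  have := affine_on_line (g k y - g k 0) sZ (gZ k) sZ.1 Zy.
  rewrite add0r -/d => ->; rewrite addrAC subrr add0r.
  apply: mulr_gt0; first by lra.
  rewrite -expr2 exprn_even_gt0//= subr_eq0; exact/eqP.
move=> gz; split=> //.
suff : \forall y \near z, forall k, Z y -> g k y <= 0.
  by apply: filterS => y /= h Zy; split=> // k; exact: h.
apply: filter_forall => k.
have [nc|cst] := pselect (exists2 y, Z y & g k y <> g k 0); last first.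
  apply: nearW => y Zy.
  have cE x : Z x -> g k x = g k 0.
    by move=> Zx; apply: contrapT => h; apply: cst; exists x.
  by rewrite cE// -(cE z0).
have [u [s [[_ uc] gE]]] := gZ k.
have := gz k nc; rewrite gE subr_lt0 => us.
have nu : nbhs z [set y | Z y -> u y < s].
  move/subspace_continuousP: uc => /(_ z Zz) uz.
  exact: (uz _ (lt_nbhsl us)).
apply: (@filterS _ (nbhs z) _ _ _ _ nu) => y + Zy => /(_ Zy) ys.
by rewrite subr_le0 ltW.
Qed.

End polyhedra.

(* The pieces are indexed by 'I_n in the statement, but arise from other finite
   types, some indices of which have to be discarded. *)
Lemma bigcup_fin (V : Type) (J : finType) (B : set J) (P : J -> set V)
    (Q : set V -> Prop) : (forall j, B j -> Q (P j)) ->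
  exists n (P' : 'I_n -> set V),
    (forall i, Q (P' i)) /\ \bigcup_(j in B) P j = \bigcup_i P' i.
Proof.
move=> QP; pose S := [pred j | `[< B j >]].
exists #|S|, (fun i => P (enum_val i)); split=> [i|].
  by apply: QP; have /asboolP := enum_valP i.
apply/seteqP; split=> [x [j Bj Px]|x [i _ Px]].
  have Sj : j \in S by exact/asboolP.
  by exists (enum_rank_in Sj j); rewrite ?enum_rankK_in.
by exists (enum_val i) => //; have /asboolP := enum_valP i.
Qed.

Lemma face_in_argmax (R : realType) (V : normedModType R) (W P : set V)
    (u : V -> R) x0 :
  functional_on W u -> P x0 -> (forall x, P x -> u x <= u x0) ->
  face_in W P [set x | P x /\ u x = u x0].
Proof.
move=> uW Px0 umax; exists u => //.
have -> : ereal_sup [set (u y)%:E | y in P] = (u x0)%:E.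
  apply/eqP; rewrite eq_le; apply/andP; split.
    by apply: ge_ereal_sup => _ [x Px <-]; rewrite lee_fin umax.
  by apply: ereal_sup_ubound; exists x0.
by apply/seteqP; split=> x [Px ux]; split=> //; [rewrite ux|case: ux].
Qed.

(** * The reduced problem *)

Lemma sumset_mono (R : realType) (V : lmodType R) (A B B' : set V) :
  B `<=` B' -> sumset A B `<=` sumset A B'.
Proof. by move=> BB' _ [x Ax [y /BB' By <-]]; exists x => //; exists y. Qed.

Lemma vsubspace_sumset (R : realType) (V : lmodType R) (A B : set V) :
  vsubspace A -> vsubspace B -> vsubspace (sumset A B).
Proof.
move=> sA sB; split.
  by exists 0; [exact: sA.1|exists 0; [exact: sB.1|rewrite addr0]].
move=> c _ _ [x Ax [y By <-]] [x' Ax' [y' By' <-]].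
exists (c *: x + x'); first exact: sA.2.
exists (c *: y + y'); first exact: sB.2.
by rewrite scalerDr addrACA.
Qed.

Section projection.
Context {R : realType} {V : lmodType R} (W Z : set V).
Context (sW : vsubspace W) (sZ : vsubspace Z)
  (WZ0 : forall y, W y -> Z y -> y = 0).

Lemma proj_alongE w z : W w -> Z z -> proj_along W Z (w + z) = z.
Proof.
move=> Ww Zz; apply: xget_subset1; first by split=> //; exists w.
move=> z1 z2 [Zz1 [w1 Ww1 e1]] [Zz2 [w2 Ww2 e2]].
apply/eqP; rewrite -subr_eq0; apply/eqP/WZ0; last exact: vsubspaceB.
have -> : z1 - z2 = w2 - w1.
  have -> : z1 = w + z - w1 by rewrite e1 addrC addKr.
  have -> : z2 = w + z - w2 by rewrite e2 addrC addKr.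
  by rewrite opprB addrC addrA subrK.
exact: vsubspaceB.
Qed.

Lemma proj_along_mem y : sumset W Z y -> Z (proj_along W Z y).
Proof. by move=> [w Ww [z Zz <-]]; rewrite proj_alongE. Qed.

Lemma proj_along_linear : linear_on (sumset W Z) (proj_along W Z).
Proof.
move=> a _ _ [w Ww [z Zz <-]] [w' Ww' [z' Zz' <-]].
rewrite scalerDr addrACA !proj_alongE//; first exact: sW.2.
exact: sZ.2.
Qed.

(** This puts the projected cone in the existential form to which elimination applies. *)
Lemma image_proj_along (S : set V) :
  proj_along W Z @` (sumset W Z `&` S) =
  [set z | Z z /\ exists2 w, W w & S (w + z)].
Proof.
apply/seteqP; split=> [_ [_ [[w Ww [z Zz <-]] Sy] <-]|z [Zz [w Ww Sy]]].
  by rewrite proj_alongE//; split=> //; exists w.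
exists (w + z); last exact: proj_alongE.
by split=> //; exists w => //; exists z.
Qed.

End projection.

Section reduction.
Context {R : realType} {X Y : normedModType R}.
Context (p : plp_data X Y) (r : reduction_data X Y).
Context (hp : plp_setting p) (hr : reduction_of p r).

Lemma vsubspace_TX1 : vsubspace (TX1 p).
Proof.
split; first by exists 0; [split=> *; rewrite linear0|rewrite linear0].
move=> a _ _ [x [ux xx] <-] [y [uy xy] <-].
exists (a *: x + y); last by rewrite linearP.
by split=> i k; rewrite linearP /= ?ux ?uy ?xx ?xy /GRing.scale /= mulr0 addr0.
Qed.

Lemma vsubspace_X2 : vsubspace (X2 r).
Proof. exact: vsubspace_span. Qed.

Lemma vsubspace_Z : vsubspace (Z r).
Proof. exact: vsubspace_span. Qed.

(** Otherwise take the last [red_w r k] with a nonzero coefficient in [y]. Solving for it places it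
    in the sum of [TX1 p] and the span of its predecessors, against its choice. *)
Lemma TX1_Z_eq0 y : TX1 p y -> Z r y -> y = 0.
Proof.
move=> Ty; rewrite /Z span_rangeE => -[a yE].
have [[k0 ak0]|a0] := pselect (exists k, a k != 0); last first.
  rewrite yE big1// => k _; have [->|ak] := eqVneq (a k) 0.
    by rewrite scale0r.
  by exfalso; apply: a0; exists k.
case: (@arg_maxnP _ k0 (fun k => a k != 0) val ak0) => k ak kmax.
have [_ []] := w_successive hr k.
pose S := \sum_(k' | k' != k) a k' *: red_w r k'.
exists ((a k)^-1 *: y); first exact: vsubspaceZ vsubspace_TX1 Ty.
exists (- (a k)^-1 *: S); last first.
  rewrite yE (bigD1 k)//= -/S scalerDr scalerA mulVf// scale1r.
  by rewrite scaleNr addrK.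
apply: vsubspaceZ; first exact: vsubspace_span.
apply: vsubspace_sum => [|k' k'k]; first exact: vsubspace_span.
have [k'_lt|k_le] := ltnP k' k.
  by apply: vsubspaceZ; [exact: vsubspace_span|apply: subset_span; exists k'].
have [->|ak'] := eqVneq (a k') 0.
  by rewrite scale0r; exact: (vsubspace_span _).1.
have := kmax k' ak' => /= le; exfalso; move/negP: k'k; apply.
by apply/eqP/val_inj/eqP; rewrite eqn_leq; exact/andP.
Qed.

(** An element outside could be appended to [red_w r], giving a successive family longer than the
    maximal length. *)
Lemma Dset_sub : Dset p (red_h r) `<=` TX1Z p r.
Proof.
move=> y Dy; apply: contrapT => yTZ.
pose w (k : 'I_(red_sigma r).+1) :=
  if unlift ord_max k is Some k' then red_w r k' else y.
suff /(sigma_maximal hr) : successive p (Dset p (red_h r)) w by rewrite ltnn.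
move=> k; rewrite {1 3}/w; case: unliftP => [j ->|->].
  have [Dw wn] := w_successive hr j; split=> //; apply: contra_not wn.
  apply: sumset_mono; apply: span_min; first exact: vsubspace_span.
  move=> _ [k' k'j <-]; apply: subset_span; rewrite /w.
  case: unliftP k'j => [j' ->|->]; rewrite /mkset !lift_max.
    by move=> j'j; exists j'.
  by rewrite ltnNge ltnW.
split=> //; apply: contra_not yTZ.
apply: sumset_mono; apply: span_min; first exact: vsubspace_span.
move=> _ [k' /= k'j <-]; apply: subset_span; rewrite /w.
case: unliftP k'j => [j' ->|->]; first by exists j'.
by rewrite ltnn.
Qed.

Lemma vsubspace_TX1Z : vsubspace (TX1Z p r).
Proof. exact: vsubspace_sumset vsubspace_TX1 vsubspace_Z. Qed.

Lemma T_X2 i x : X2 r x -> TX1Z p r (pl_T p i x).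
Proof.
rewrite /X2 span_rangeE => -[a ->]; rewrite linear_sum.
apply: vsubspace_sum => [|k _]; first exact: vsubspace_TX1Z.
rewrite linearZ; apply: vsubspaceZ; first exact: vsubspace_TX1Z.
by apply: Dset_sub; exists i; left; exists k.
Qed.

Lemma b_TX1Z i : TX1Z p r (pl_b p i).
Proof. by apply: Dset_sub; exists i; right. Qed.

Lemma PiZ_linear : linear_on (TX1Z p r) (PiZ p r).
Proof. exact: proj_along_linear vsubspace_TX1 vsubspace_Z TX1_Z_eq0. Qed.

Lemma PiZ_T_linear i : linear_on (X2 r) (fun x => PiZ p r (pl_T p i x)).
Proof. by move=> a x y Xx Xy; rewrite linearP PiZ_linear//; exact: T_X2. Qed.

Lemma PiZ_mem y : TX1Z p r y -> Z r (PiZ p r y).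
Proof. exact: proj_along_mem vsubspace_TX1 vsubspace_Z TX1_Z_eq0 _. Qed.

Lemma LPobjE i x : X2 r x ->
  LPobj p r i x = PiZ p r (pl_T p i x) + PiZ p r (pl_b p i).
Proof.
by move=> Xx; apply: linear_onD PiZ_linear (T_X2 i Xx) (b_TX1Z i).
Qed.

Lemma LPobj_mem i x : X2 r x -> Z r (LPobj p r i x).
Proof.
move=> Xx; apply: PiZ_mem; apply: vsubspaceD (b_TX1Z i).
  exact: vsubspace_TX1Z.
exact: T_X2.
Qed.

Lemma fhat_Phat i x : Phat p r i x -> fhat p r x = LPobj p r i x.
Proof. by move=> [_ Px]; rewrite /fhat (f_piece hp (i := i)). Qed.

Lemma Ahati_X2 i : Ahati p r i `<=` X2 r.
Proof. by move=> x [[]]. Qed.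

Lemma Ahat_bigcup : Ahat p r = \bigcup_i Ahati p r i.
Proof.
apply/seteqP; split=> x.
  move=> [Xx phix]; have : [set: X] x by [].
  rewrite -(piece_cover hp) => -[i _ Px]; exists i => //; split=> // j.
  by have := phix j; rewrite (phi_piece hp (i := i))// subr_le0.
move=> [i _ [[Xx Px] xx]]; split=> // j.
by rewrite (phi_piece hp (i := i))// subr_le0.
Qed.

Lemma fhat_Ahat : fhat p r @` Ahat p r = \bigcup_i (LPobj p r i @` Ahati p r i).
Proof.
rewrite Ahat_bigcup image_bigcup; apply: eq_bigcupr => i _.
by apply: eq_imagel => x [Px _]; exact: fhat_Phat.
Qed.

(** Additivity of [PiZ] absorbs the shift by [PiZ p r (pl_b p i)], so membership becomes a condition
    on the objective value alone. *)
Lemma SbreveE i :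
  Sbreve p r i = [set x | Ahati p r i x /\ Vhat p r i (LPobj p r i x)].
Proof.
apply/seteqP; split=> x [Ax]; have Xx := Ahati_X2 Ax.
  by move=> [_ [v Vv]] /esym e; split=> //; rewrite LPobjE// e subrK.
move=> Vx; split=> //; split=> //; exists (LPobj p r i x) => //.
by rewrite LPobjE// addrK.
Qed.

Lemma WE_inE (V : normedModType R) (W A K : set V) :
  WE_in W A K = A `\` sumset A (interior_in W K).
Proof.
apply/seteqP; split=> y [Ay ny]; split=> //; apply: contra_not ny.
  by move=> [v Av [k Kk <-]]; exists v => //; rewrite addrC addKr.
by move=> [v Av Kk]; exists v => //; exists (y - v) => //; rewrite addrC subrK.
Qed.

Lemma Vhat_Ibar i : ~ Ibar p r i -> Vhat p r i = set0.
Proof.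
by move=> nI; rewrite -subset0 => y [[x Ax _] _]; apply: nI; exists x.
Qed.

Lemma weak_efficient_values :
  WE_in (Z r) (fhat p r @` Ahat p r) (CZ p r) =
    \bigcup_(i in Ibar p r) Vhat p r i.
Proof.
rewrite WE_inE {1}fhat_Ahat setD_bigcupl.
apply/seteqP; split=> [y [i _ Vy]|y [i _ Vy]]; last by exists i.
exists i => //; apply: contrapT => /Vhat_Ibar V0.
by move: Vy; rewrite -/(Vhat p r i) V0.
Qed.

Lemma weak_Pareto_solutions : Shat p r = \bigcup_(i in Ibar p r) Sbreve p r i.
Proof.
rewrite /Shat Ahat_bigcup WE_inE; apply/seteqP; split=> x.
  move=> [[i _ Ax] [_ nx]]; exists i; first by exists x.
  rewrite SbreveE; split=> //; split; first by exists x.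
  by rewrite -(fhat_Phat Ax.1) Ahat_bigcup.
move=> [i _]; rewrite SbreveE => -[Ax [_ nx]]; split; first by exists i.
rewrite (fhat_Phat Ax.1); split; last by rewrite -Ahat_bigcup.
by exists x; [exists i|exact: fhat_Phat Ax.1].
Qed.

End reduction.

(** * Polyhedral ordering cone: dominated values and weak Pareto faces *)

Section polyhedral_cone.
Context {R : realType} {X Y : normedModType R}.
Context (p : plp_data X Y) (r : reduction_data X Y).
Context (hp : plp_setting p) (hr : reduction_of p r)
  (polyC : polyhedron_in [set: Y] (pl_C p)).

(** The constraints constant on [Z] are discarded, so that the interior is given by strict
    inequalities throughout. The bound at 0 comes from [0] being in the cone. *)
Lemma interior_CZ : exists (K : finType) (g : K -> Y -> R),
  [/\ forall k, affine_on (Z r) (g k), forall k, g k 0 <= 0 &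
      forall z, interior_in (Z r) (CZ p r) z <->
        Z r z /\ forall k, g k z < 0].
Proof.
have sT := vsubspace_TX1 p; have sZ := vsubspace_Z r.
have [K [g [gZ gE]]] := projection_polyhedron (Z r) sT polyC.
have CZE : CZ p r = [set z | Z r z /\ forall k, g k z <= 0].
  rewrite /CZ (image_proj_along sT sZ (TX1_Z_eq0 hr)).
  by apply/seteqP; split=> z [Zz] /gE.
have g0 k : g k 0 <= 0.
  apply: (gE 0).1; exists 0; first exact: sT.1.
  have [[y Cy] _ Cs] := C_convex_cone hp.
  by rewrite addr0 -(scale0r y); exact: Cs.
pose nonconst k := `[< exists2 y, Z r y & g k y <> g k 0 >].
exists {k | nonconst k}, (fun k => g (val k)); split=> [k|k|z].
- exact: gZ.
- exact: g0.
rewrite CZE (interior_in_polyhedron sZ gZ); last by exists 0; first exact: sZ.1.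
split=> -[Zz gz]; split=> // k; first exact/gz/asboolP/(valP k).
by move=> /asboolP nk; exact: (gz (exist _ k nk)).
Qed.

(** Each constraint at [e *: c] is a convex combination of a nonpositive value at 0 and a negative
    value at [c], the latter with positive weight. This provides interior points arbitrarily close
    to 0. *)
Lemma interior_CZ_scale c e : interior_in (Z r) (CZ p r) c -> 0 < e <= 1 ->
  interior_in (Z r) (CZ p r) (e *: c).
Proof.
have sZ := vsubspace_Z r.
have [K [g [gZ g0 gE]]] := interior_CZ.
move=> /gE[Zc gc] e01; apply/gE; split=> [|k]; first exact: vsubspaceZ.
have := affine_on_line e sZ (gZ k) sZ.1 Zc.
by rewrite add0r => ->; have := gc k; have := g0 k; nra.
Qed.

Lemma affine_on_LPobj g i x : affine_on (Z r) g -> X2 r x ->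
  g (LPobj p r i x) =
    g (PiZ p r (pl_T p i x)) + g (PiZ p r (pl_b p i)) - g 0.
Proof.
move=> gZ Xx; rewrite LPobjE// -[PiZ p r (pl_b p i)]scale1r.
rewrite (affine_on_line _ (vsubspace_Z r) gZ).
- by rewrite scale1r mul1r addrA.
- by apply: PiZ_mem => //; exact: T_X2.
- by apply: PiZ_mem => //; exact: b_TX1Z.
Qed.

Lemma affine_on_T_linear g i : affine_on (Z r) g ->
  linear_on (X2 r) (fun x => g (PiZ p r (pl_T p i x)) - g 0 : R^o).
Proof.
move=> [u [s [uZ ->]]] a x y Xx Xy.
have PT x' : X2 r x' -> Z r (PiZ p r (pl_T p i x')).
  by move=> Xx'; apply: PiZ_mem => //; exact: T_X2.
have := linear_on0 (vsubspace_Z r) (functional_on_linear uZ); rewrite /= => ->.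
rewrite (PiZ_T_linear hr)// uZ.1; [|exact: PT..].
by rewrite /GRing.scale /=; ring.
Qed.

(** The [red_e] are among the continuous [pl_u] and [pl_x] and are biorthogonal to [red_h].
    Constraints pulled back from [Z] to [X2] are thus continuous as soon as they are linear, and no
    continuity of [PiZ] enters. *)
Lemma functional_on_X2 (u : X -> R^o) :
  linear_on (X2 r) u -> functional_on (X2 r) u.
Proof.
apply: functional_on_span (e_h hr) => k.
have [sub _ _] := e_maximal hr.
have : all_functionals p (red_e r k) by apply: sub; exists k.
by move=> [] [i [j ->]]; [exact: u_continuous hp _ _|exact: x_continuous hp _ _].
Qed.

Definition dominated i : set Y :=
  sumset (LPobj p r i @` Ahati p r i) (interior_in (Z r) (CZ p r)).

(* Eliminating the decision variable from the description of the dominated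
   values leaves strict inequalities only: the weak ones stem from [Ahati],
   which does not involve [z], so they are constant. *)
Lemma dominatedE i : exists (J : finType) (g : J -> Y -> R),
  (forall j, affine_on (Z r) (g j)) /\
  forall z, Z r z -> dominated i z <-> forall j, g j z < 0.
Proof.
have sZ := vsubspace_Z r; have sX := vsubspace_X2 r.
have [K [g [gZ _ gE]]] := interior_CZ.
pose P C h := affine_on (Z r) h /\ (C -> exists c : R, h = fun=> c).
(* The indices in [K] express that [z - LPobj p r i x] is interior to the cone, the others that [x]
   lies in [Ahati p r i]. *)
pose I : finType := (K + ('I_(pl_q p i) + 'I_(pl_l p)))%type.
pose C (k : I) := if k is inr _ then true else false.
pose G (k : I) : Y -> R := match k with
  | inl k => fun z => g k z + (g k 0 - g k (PiZ p r (pl_b p i)))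
  | inr (inl k) => fun=> - pl_t p i k
  | inr (inr j) => fun=> - pl_c p i j end.
pose b (k : I) : X -> R^o := match k with
  | inl k => fun x => - (g k (PiZ p r (pl_T p i x)) - g k 0)
  | inr (inl k) => pl_u p i k
  | inr (inr j) => pl_x p i j end.
have bl k : linear_on (X2 r) (b k).
  case: k => [k|[k|j]]; last 2 first.
  - by move=> a x y _ _; rewrite /b linearP.
  - by move=> a x y _ _; rewrite /b linearP.
  exact: linear_onN (affine_on_T_linear i (gZ k)).
have Pcomb : combinable P.
  move=> C1 C2 h h' a a' _ _ [hZ hc] [h'Z h'c].
  split=> [|/andP[/hc[c ->] /h'c[c' ->]]]; first exact: affine_onC.
  by exists (a * c + a' * c').
have PG k : P (C k) (G k).
  case: k => [k|[k|j]]; split=> //=.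
  - have := affine_onC 1 1 (gZ k)
      (affine_on_cst (Z r) (g k 0 - g k (PiZ p r (pl_b p i)))).
    by under eq_fun do rewrite !mul1r.
  - exact: affine_on_cst.
  - by exists (- pl_t p i k).
  - exact: affine_on_cst.
  - by exists (- pl_c p i j).
have [J [C' [h [Ph hE]]]] := eliminate_subspace sX bl Pcomb PG.
(* A weak constraint is constant in [z]: it is replaced by the constant -1 if it holds and by 0 if
   it fails, so that the strict inequality has the same truth value. *)
exists J, (fun j z => if C' j then if h j 0 <= 0 then -1 else 0 else h j z).
split=> [j|z Zz]; first by case: (C' j); [exact: affine_on_cst|exact: (Ph j).1].
have -> : (forall j, (if C' j then if h j 0 <= 0 then -1 else 0 else h j z) < 0)
    <-> forall j, h j z < 0 ?<= if C' j.
  split=> H j; have := H j; have := (Ph j).2; case: (C' j) => //= /(_ isT)[c ->].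
    by case: ifP => //; rewrite ltxx.
  by move=> ->; rewrite ltrN10.
rewrite -hE.
have gLP k x : X2 r x -> G (inl k) z + b (inl k) x = g k (z - LPobj p r i x).
  move=> Xx; rewrite -scaleN1r (affine_on_line _ sZ (gZ k))//; last first.
    exact: LPobj_mem.
  by rewrite (affine_on_LPobj _ (gZ k))// /G /b; ring.
split=> [[_ [x Ax <-] [c /gE[Zc gc] zE]]|[x Xx xP]].
  have Xx := Ahati_X2 Ax; exists x => // -[k|[k|j]]; last 2 first.
  - by rewrite /= addrC subr_le0; exact: Ax.1.2.
  - by rewrite /= addrC subr_le0; exact: Ax.2.
  by rewrite (gLP k x Xx) -zE [X in g k X]addrC addKr; exact: gc.
exists (LPobj p r i x).
  exists x => //; split=> [|j]; last first.
    by have := xP (inr (inr j)); rewrite /= addrC subr_le0.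
  by split=> // k; have := xP (inr (inl k)); rewrite /= addrC subr_le0.
exists (z - LPobj p r i x); last by rewrite addrC subrK.
apply/gE; split=> [|k]; first by apply: vsubspaceB => //; exact: LPobj_mem.
by rewrite -gLP//; exact: xP (inl k).
Qed.

Lemma dominated_bigcup :
  sumset (fhat p r @` Ahat p r) (interior_in (Z r) (CZ p r)) =
    \bigcup_i dominated i.
Proof.
rewrite (fhat_Ahat r hp); apply/seteqP; split=> [_ [v [i _ vi] [c Cc <-]]|].
  by exists i => //; exists v => //; exists c.
by move=> _ [i _ [v vi [c Cc <-]]]; exists v; [exists i|exists c].
Qed.

Lemma ShatiE i :
  Shati p r i = [set x | Ahati p r i x /\ ~ dominated i (LPobj p r i x)].
Proof.
rewrite /Shati WE_inE; apply/seteqP; split=> x [Ax]; first by move=> [_].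
by move=> nd; split=> //; split=> //; exists x.
Qed.

(** Values [LPobj p r i x] are limits of dominated ones, so [g] is nonpositive at them. The
    condition [0 <= g] then singles out the points where the maximum 0 is attained; there [g] is not
    negative, so the values are not dominated. *)
Lemma subset_weak_Pareto_face i g x0 : affine_on (Z r) g ->
  (forall z, Z r z -> dominated i z -> g z < 0) ->
  Ahati p r i x0 -> 0 <= g (LPobj p r i x0) ->
  exists F, weak_Pareto_face p r i F /\
    [set x | Ahati p r i x /\ 0 <= g (LPobj p r i x)] `<=` F.
Proof.
move=> gZ gdom Ax0 gx0; have sZ := vsubspace_Z r.
(* With empty interior nothing is dominated, and the zero functional exposes all of
   [Ahati p r i]. *)
have [[c Cc]|C0] := pselect (interior_in (Z r) (CZ p r) !=set0); last first.
  exists (Ahati p r i); split; last by move=> x [].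
  split=> [|x Ax]; last first.
    rewrite ShatiE; split=> // -[_ _ [c Cc _]]; by apply: C0; exists c.
  have := face_in_argmax (functional_on0 (X2 r)) Ax0 (fun _ _ => lexx _).
  by congr face_in; apply/seteqP; split=> x; [case|].
have Zc : Z r c by case: Cc.
have gle x : Ahati p r i x -> g (LPobj p r i x) <= 0.
  move=> Ax; rewrite leNgt; apply/negP => g_gt0.
  set z := LPobj p r i x in g_gt0 *.
  have Zz : Z r z by apply: LPobj_mem => //; exact: Ahati_X2 Ax.
  (* With this [e], the value [g z + e * d] at [z + e *: c] is at least [e * g z], which is
     positive, although the point is dominated. *)
  pose d := g c - g 0; pose e := g z / (g z + `|d|).
  have s_gt0 : 0 < g z + `|d| by rewrite ltr_pwDl.
  have e01 : 0 < e <= 1.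
    by rewrite divr_gt0//= ler_pdivrMr// mul1r lerDl.
  have Zec : Z r (z + e *: c) by apply: vsubspaceD => //; exact: vsubspaceZ.
  have : dominated i (z + e *: c).
    exists z; first by exists x.
    by exists (e *: c) => //; exact: interior_CZ_scale.
  move=> /(gdom _ Zec); rewrite (affine_on_line _ sZ gZ)// -/d.
  have : - `|d| <= d by rewrite lerNl -normrN ler_norm.
  have : e * (g z + `|d|) = g z by rewrite divfK// gt_eqF.
  nra.
pose u x := g (PiZ p r (pl_T p i x)) - g 0.
have uX : functional_on (X2 r) u.
  by apply: functional_on_X2; exact: affine_on_T_linear.
have uE x : Ahati p r i x -> g (LPobj p r i x) = u x + g (PiZ p r (pl_b p i)).
  by move=> /Ahati_X2 Xx; rewrite affine_on_LPobj// addrAC.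
have umax x : Ahati p r i x -> u x <= u x0.
  by move=> Ax; have := gle x Ax; have := gx0; rewrite !uE//; lra.
exists [set x | Ahati p r i x /\ u x = u x0]; split; last first.
  move=> x [Ax]; rewrite uE// => gx; split=> //.
  by have := umax x Ax; have := gle x0 Ax0; rewrite uE//; lra.
split; first exact: face_in_argmax.
move=> x [Ax ux]; rewrite ShatiE; split=> //.
have Zx : Z r (LPobj p r i x) by apply: LPobj_mem => //; exact: Ahati_X2 Ax.
by move/(gdom _ Zx); rewrite uE// ux -uE// ltNge gx0.
Qed.

Lemma Sbreve_pieces i : exists n (P : 'I_n -> set X),
  (forall j, polyhedron_in (X2 r) (P j) /\
     exists F, weak_Pareto_face p r i F /\ P j `<=` F) /\
  Sbreve p r i = \bigcup_j P j.
Proof.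
pose J i' := projT1 (cid (dominatedE i')).
pose g i' : J i' -> Y -> R := projT1 (cid (projT2 (cid (dominatedE i')))).
have gP i' : (forall j, affine_on (Z r) (@g i' j)) /\
    forall z, Z r z -> dominated i' z <-> forall j, @g i' j z < 0.
  exact: projT2 (cid (projT2 (cid (dominatedE i')))).
(* A selection [s] names, for each piece, an inequality which prevents the
   value from being dominated by that piece. *)
pose S (s : {dffun forall i', J i'}) : set X :=
  [set x | Ahati p r i x /\ forall i', 0 <= g i' (s i') (LPobj p r i x)].
(* Keeping only nonempty [S s] supplies the point at which the exposing functional attains its
   maximum. *)
have -> : Sbreve p r i = \bigcup_(s in [set s | S s !=set0]) S s.
  rewrite SbreveE//; apply/seteqP; split=> x.
    move=> [Ax [_]]; rewrite dominated_bigcup => nd.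
    have Zx : Z r (LPobj p r i x) by apply: LPobj_mem => //; exact: Ahati_X2 Ax.
    have sP i' : exists j, 0 <= g i' j (LPobj p r i x).
      apply: contrapT => H; apply: nd; exists i' => //.
      apply/(gP i').2 => // j; rewrite ltNge; apply/negP => ?; apply: H.
      by exists j.
    pose s : {dffun forall i', J i'} := finfun (fun i' => projT1 (cid (sP i'))).
    have Ss : S s x by split=> // i'; rewrite ffunE; exact: projT2 (cid (sP i')).
    by exists s => //; exists x.
  move=> [s _ [Ax sx]]; split=> //; split; first by exists x.
  have Zx : Z r (LPobj p r i x) by apply: LPobj_mem => //; exact: Ahati_X2 Ax.
  rewrite dominated_bigcup => -[i' _ /((gP i').2 _ Zx)/(_ (s i'))].
  by rewrite ltNge sx.
apply: (bigcup_fin (Q := fun P => polyhedron_in (X2 r) P /\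
  exists F, weak_Pareto_face p r i F /\ P `<=` F)) => s [x0 [Ax0 sx0]]; split.
  pose K : finType := ('I_(pl_q p i) + ('I_(pl_l p) + 'I_(pl_m p).+1))%type.
  pose u (k : K) : X -> R^o := match k with
    | inl k => pl_u p i k | inr (inl j) => pl_x p i j
    | inr (inr i') =>
      fun x => - (g i' (s i') (PiZ p r (pl_T p i x)) - g i' (s i') 0) end.
  pose c (k : K) : R := match k with
    | inl k => pl_t p i k | inr (inl j) => pl_c p i j
    | inr (inr i') => g i' (s i') (PiZ p r (pl_b p i)) end.
  have uX k : functional_on (X2 r) (u k).
    apply: functional_on_X2.
    case: k => [k|[j|i']].
    - by move=> a x y _ _; rewrite /u linearP.
    - by move=> a x y _ _; rewrite /u linearP.
    - exact: linear_onN (affine_on_T_linear i ((gP i').1 _)).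
  have -> : S s = [set x | X2 r x /\ forall k, u k x <= c k].
    apply/seteqP; split=> x.
      move=> [Ax sx]; split=> [|[k|[j|i']]]; first exact: Ahati_X2 Ax.
      - exact: Ax.1.2.
      - exact: Ax.2.
      have := sx i'; rewrite (affine_on_LPobj i ((gP i').1 _)).
        by rewrite /u /c; lra.
      exact: Ahati_X2 Ax.
    move=> [Xx ux]; split=> [|i'].
      split=> [|j]; last exact: (ux (inr (inl j))).
      by split=> // k; exact: (ux (inl k)).
    rewrite (affine_on_LPobj i ((gP i').1 _))//.
    by have := ux (inr (inr i')); rewrite /u /c; lra.
  exact: polyhedron_in_finite.
(* Of all the selected inequalities, the one for piece [i] itself yields the face. *)
have [z Zz /((gP i).2 z Zz)//|F [FP FS]] :=
  subset_weak_Pareto_face ((gP i).1 (s i)) _ Ax0 (sx0 i).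
by exists F; split=> // x [Ax sx]; apply: FS; split=> //; exact: sx.
Qed.

End polyhedral_cone.

Theorem theorem4p3 (R : realType) (X Y : normedModType R)
    (p : plp_data X Y) (r : reduction_data X Y)
    (hp : plp_setting p) (hr : reduction_of p r)
    (hint : (TX1Z p r `&` (pl_C p)°) !=set0) :
  (Shat p r = \bigcup_(i in Ibar p r) Sbreve p r i /\
   WE_in (Z r) (fhat p r @` Ahat p r) (CZ p r) =
     \bigcup_(i in Ibar p r) Vhat p r i) /\
  (polyhedron_in [set: Y] (pl_C p) ->
   (forall i, Ibar p r i ->
      exists (n : nat) (P F : 'I_n -> set X),
        [/\ forall j, polyhedron_in (X2 r) (P j),
            forall j, face_in (X2 r) (Ahati p r i) (F j),
            Sbreve p r i = \bigcup_j P j &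
            forall j, P j `<=` F j /\ F j `<=` Shati p r i]) /\
   (exists (n : nat) (P : 'I_n -> set X),
      [/\ forall j, polyhedron_in (X2 r) (P j),
          Shat p r = \bigcup_j P j &
          forall j, exists (i : 'I_(pl_m p).+1) (F : set X),
            weak_Pareto_face p r i F /\ P j `<=` F])).
Proof.
split; first by split; [exact: weak_Pareto_solutions|exact: weak_efficient_values].
move=> polyC; have pieces := Sbreve_pieces hp hr polyC; split=> [i _|].
  have [n [P [PP ->]]] := pieces i.
  pose F j := projT1 (cid (PP j).2).
  have FP j : weak_Pareto_face p r i (F j) /\ P j `<=` F j.
    exact: projT2 (cid (PP j).2).
  exists n, P, F; split=> // j; first exact: (PP j).1.
    exact: (FP j).1.1.
  by split; [exact: (FP j).2|exact: (FP j).1.2].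
pose n i := projT1 (cid (pieces i)).
pose P i : 'I_(n i) -> set X := projT1 (cid (projT2 (cid (pieces i)))).
have PP i : (forall j, polyhedron_in (X2 r) (@P i j) /\
     exists F, weak_Pareto_face p r i F /\ @P i j `<=` F) /\
    Sbreve p r i = \bigcup_j @P i j.
  exact: projT2 (cid (projT2 (cid (pieces i)))).
(* The polyhedra of all subproblems form one family over a dependent sum, restricted to the indices
   [i] in [Ibar p r]. *)
have [|N [Q [QP QE]]] := @bigcup_fin X {i : 'I_(pl_m p).+1 & 'I_(n i)}
    [set j | Ibar p r (tag j)] (fun j => P (tag j) (tagged j))
    (fun S => polyhedron_in (X2 r) S /\
      exists i F, weak_Pareto_face p r i F /\ S `<=` F).
  move=> [i j] _ /=; have [pol [F FP]] := (PP i).1 j.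
  by split=> //; exists i, F.
exists N, Q; split=> [j||j]; [exact: (QP j).1| |exact: (QP j).2].
rewrite (weak_Pareto_solutions hp hr) -QE; apply/seteqP; split=> x.
  move=> [i Ii]; rewrite (PP i).2 => -[j _ Px].
  by exists (Tagged (fun i => 'I_(n i)) j).
move=> [[i j] /= Ii Px]; exists i => //.
by rewrite (PP i).2; exists j.
Qed.
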